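(* Let $q=p^f$ with $p$ prime, let $\mathbf{x}$ be a point of $\mathsf{W}(3,q)$, and let $\mathcal{Q}^x$ be the generalised quadrangle of order $(q-1,q+1)$ obtained by Payne derivation from $\mathsf{W}(3,q)$ at $\mathbf{x}$. Then there exist distinct subgroups $E$ and $P$ of $\mathrm{Aut}(\mathcal{Q}^x)$ that act regularly on the points of $\mathcal{Q}^x$, and, if $q$ is not a prime, there also exists a further subgroup $S$ of $\mathrm{Aut}(\mathcal{Q}^x)$ acting regularly on the points of $\mathcal{Q}^x$, such that $E$, $P$ and $S$ have the following properties: (1) $E$ is an elation group of $\mathsf{W}(3,q)$ while $P$ and $S$ are not; (2) $E\not\cong S$ and $P\not\cong S$; (3) $E\cong P$ if and only if $q$ is not a power of $2$ or $3$; (4) for $q$ even: (a) $E$ is elementary abelian while $S$ and $P$ have exponent $4$ and are nonabelian, except when $q=2$; (b) $P'<Z(P)$ and $S'<Z(S)$ (in particular $P$ and $S$ are not special); (5) for $q=3^f$, $E$ has exponent $3$ while $P$ and $S$ have exponent $9$; (6) for $q$ odd, $Z(P)=P'=Z(E)=E'$ and $Z(S)<S'$ (in particular $P$ and $E$ are special while $S$ is not).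
   Context: $\mathsf{W}(3,q)$ is the symplectic generalised quadrangle of order $(q,q)$: its points are all $1$-dimensional subspaces of $\mathrm{GF}(q)^4$ and its lines are the $2$-dimensional subspaces totally isotropic for a nondegenerate alternating form; its automorphism group is $\mathrm{P\Gamma Sp}(4,q)$. For a set $S$ of points, $S^\perp$ is the set of points collinear with every point of $S$ (a point is considered collinear with itself). Payne derivation: for every point $y$ not collinear with $\mathbf{x}$, the set $\{\mathbf{x},y\}^{\perp\perp}$ has $q+1$ points; $\mathcal{Q}^x$ has as points the points of $\mathsf{W}(3,q)$ not collinear with $\mathbf{x}$, and as lines the lines of $\mathsf{W}(3,q)$ not incident with $\mathbf{x}$ together with the sets $\{\mathbf{x},y\}^{\perp\perp}$ ($y$ not collinear with $\mathbf{x}$) with $\mathbf{x}$ removed. The stabiliser of $\mathbf{x}$ in $\mathrm{P\Gamma Sp}(4,q)$ acts faithfully as a group of automorphisms of $\mathcal{Q}^x$, and so its subgroups may be regarded both as automorphism groups of $\mathsf{W}(3,q)$ and of $\mathcal{Q}^x$. An elation group of a generalised quadrangle with base point $y$ is a group of automorphisms fixing $y$ and each line through $y$ and acting regularly on the points not collinear with $y$. A $p$-group $G$ is special if $Z(G)=G'=\Phi(G)$. *)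

(* Defs.v *)
Set Warnings "-notation-overridden,-ambiguous-paths".
From HB Require Import structures.
From mathcomp Require Import all_boot all_order all_algebra all_fingroup
  all_solvable.

Set Implicit Arguments.
Unset Strict Implicit.
Unset Printing Implicit Defensive.

Import GRing.Theory GroupScope.

Section PointLineGeometry.

(* A line is identified with the set of points incident with it. *)
Variables (T : finType) (lines : {set {set T}}).

(* Reflexive as soon as every point is on a line. *)
Definition collinear (y z : T) : bool :=
  [exists L in lines, (y \in L) && (z \in L)].

Definition perp (A : {set T}) : {set T} :=
  [set z | [forall y in A, collinear y z]].

(* Since lines are sets of points, an automorphism is determined by its action
   on points: it is a permutation of the points stabilising the set of lines. *)
Definition Aut_geom : {set {perm T}} := 'N(lines | ('P)^*).
Canonical Aut_geom_group := [group of Aut_geom].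

Definition regular_on (G : {set {perm T}}) (A : {set T}) : Prop :=
  [transitive G, on A | 'P] /\ {in A, forall z, 'C_G[z | 'P] = 1}.

Definition elation_group (y : T) (G : {set {perm T}}) : Prop :=
  [/\ G \subset Aut_geom,
      G \subset 'C[y | 'P],
      {in lines, forall L : {set T}, y \in L -> G \subset 'N(L | 'P)}
    & regular_on G [set z | ~~ collinear y z]].

End PointLineGeometry.

Section PayneDerivation.

Variables (T : finType) (lines : {set {set T}}) (x : T).

Definition payne_point : predArgType := {y : T | ~~ collinear lines x y}.

(* A line not incident with x is represented by the set of its points not
   collinear with x, as these are the points of the derived geometry that are
   incident with it. *)
Definition payne_lines : {set {set payne_point}} :=
  [set val @^-1: (L : {set T}) | L in lines & x \notin L]
    :|: [set val @^-1: (perp lines (perp lines [set x; val y]) :\ x)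
          | y : payne_point].

Definition stab_geom : {set {perm T}} := 'C_(Aut_geom lines)[x | 'P].
Canonical stab_geom_group := [group of stab_geom].

(* The permutation group induced by G on the points not collinear with x; only
   meaningful for G \subset stab_geom. *)
Definition payne_restr (G : {set {perm T}}) : {set {perm payne_point}} :=
  actperm ('P^?) @* G.

Definition payne_regular (H : {set {perm payne_point}}) : Prop :=
  H \subset Aut_geom payne_lines /\ regular_on H [set: payne_point].

(* H, regarded as a group of automorphisms of the original geometry fixing x,
   is an elation group about some point of that geometry. *)
Definition is_elation (H : {set {perm payne_point}}) : Prop :=
  exists G : {group {perm T}},
    [/\ G \subset stab_geom, payne_restr G = H
      & exists y : T, elation_group lines y G].

End PayneDerivation.

Section SymplecticQuadrangle.

Local Open Scope ring_scope.

Section FiniteSubspaces.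
Import VectorInternalTheory.
Variables (K : finFieldType) (vT : vectType K).
HB.instance Definition _ := [Countable of {vspace vT} by <:].
HB.instance Definition _ := [Finite of {vspace vT} by <:].
End FiniteSubspaces.

Variable F : finFieldType.

Definition W_point : predArgType := {y : {vspace 'rV[F]_4} | \dim y == 1%N}.

Variable B : {biscalar 'rV[F]_4}.

Definition alternating_form : Prop := forall u, B u u = 0.

Definition nondegenerate_form : Prop :=
  forall u, (forall v, B u v = 0) -> u = 0.

Definition totally_isotropic (U : {vspace 'rV[F]_4}) : bool :=
  [forall u in U, forall v in U, B u v == 0].

Definition W_lines : {set {set W_point}} :=
  [set [set y : W_point | (val y <= U)%VS]
    | U : {vspace 'rV[F]_4} & (\dim U == 2) && totally_isotropic U].

End SymplecticQuadrangle.

(* Main.v *)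
(* The points of W(3,q) not collinear with x = <e0> are the points
   <z e0 + u e1 + v e2 + e3> of an affine 3-space, (e0, e1, e2, e3) being a
   symplectic frame. For an additive map f on GF(q), let g(c, a, b) be the
   symplectic transvection (u, v) |-> (u + f(b) v, v) followed by the element of
   the Heisenberg group (the elation group about x) translating the origin of
   the affine space to (c, a, b). As f is additive, these q^3 elements form a
   group acting regularly on the affine space. E, P and S are obtained from
   f = 0, f = id and f = Tr, the absolute trace. Any additive map that is neither
   zero nor injective would do for S when q is odd; for q even one also needs
   Tr(Tr(b')b - Tr(b)b') = 0, which keeps the a-coordinates of the elements of
   S' in the kernel of Tr.

   A nonzero f does not give an elation group: a base point other than x would
   contradict transitivity, and about x the line <e0, e2> is moved. E and P are
   isomorphic if 6 is invertible, since the cocycles of their group laws are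
   then cohomologous. For q odd, S differs from E and P by its centre and
   derived subgroup; for q even, E is abelian, and involutions of P are central
   while those of S need not be. *)
Require Import Defs.
From HB Require Import structures.
From mathcomp Require Import all_boot all_order all_algebra all_fingroup
  all_solvable all_field.
From mathcomp Require Import ring.

Set Implicit Arguments.
Unset Strict Implicit.
Unset Printing Implicit Defensive.

Import GRing.Theory GroupScope.

(** * Twisted Heisenberg groups *)

Section TwistedHeisenberg.

Local Open Scope ring_scope.

Variable F : finFieldType.

(** In the geometric instance, [(c, a, b)] is the image of the origin under [r c a b], and products
    act from left to right. Isolating the group law lets the group theory be done in coordinates. *)
Record twisted_heisenberg (f : F -> F) (gT : finGroupType) (G : {group gT})
    (r : F -> F -> F -> gT) : Prop := TwistedHeisenberg {
  twistD : {morph f : x y / x + y};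
  twM : forall c a b c' a' b', (r c a b * r c' a' b')%g =
    r (c + c' + b' * (a + f b' * b) - a' * b) (a + a' + f b' * b) (b + b');
  tw_inj : forall c a b c' a' b',
    r c a b = r c' a' b' -> [/\ c = c', a = a' & b = b'];
  twG : forall c a b, r c a b \in G;
  twE : forall g, g \in G -> exists c a b, g = r c a b
}.

Section Theory.

Variables (f : F -> F) (gT : finGroupType) (G : {group gT}).
Variable r : F -> F -> F -> gT.
Hypothesis twGr : twisted_heisenberg f G r.

Let fD : {morph f : x y / x + y}. Proof. by case: twGr. Qed.
Let rM := twM twGr.
Let r_inj := tw_inj twGr.
Let rG := twG twGr.
Let Gr := twE twGr.

Lemma twist0 : f 0 = 0.
Proof. by apply: (addrI (f 0)); rewrite -fD !addr0. Qed.

Lemma tw1 : r 0 0 0 = 1%g.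
Proof.
apply: (mulgI (r 0 0 0)); rewrite rM mulg1 twist0.
by congr r; ring.
Qed.

Lemma tw_eq1 c a b : r c a b = 1%g -> [/\ c = 0, a = 0 & b = 0].
Proof. by rewrite -tw1 => /r_inj. Qed.

(** Besides [c], [a] and [b], the [n]-th right multiplication step adds [f b * b] times [n] to the
    second coordinate and [f b * b * b] times ['C(n.+1, 2)] to the first; summing gives the binomial
    coefficients. *)
Lemma twX c a b n : (r c a b ^+ n)%g =
  r (c *+ n + (f b * b * b) *+ 'C(n.+1, 3)) (a *+ n + (f b * b) *+ 'C(n, 2))
    (b *+ n).
Proof.
elim: n => [|n IHn].
  by rewrite expg0 -tw1; congr r; rewrite !mulr0n ?addr0.
by rewrite expgSr IHn rM (binS n.+1) (binS n 1) bin1; congr r; ring.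
Qed.

Lemma tw_comm c a b c' a' b' : [~ r c a b, r c' a' b'] =
  r (2%:R * (a * b' - a' * b) + b * b' * (f b' - f b)
       + (f b' * b - f b * b') * (b + b'))
    (f b' * b - f b * b') 0.
Proof.
(* Multiplying by the product in the other order avoids computing inverses. *)
apply: (mulgI (r c' a' b' * r c a b)%g).
by rewrite -commgC !rM twist0; congr r; ring.
Qed.

Lemma tw_centerP c a b : reflect
  (forall c' a' b', [~ r c a b, r c' a' b'] = 1%g) (r c a b \in 'Z(G)).
Proof.
apply: (iffP (centerP _ _)) => [[_ cGr] c' a' b' | cGr].
  by apply/eqP/commgP/cGr/rG.
split=> [|g /Gr[c' [a' [b' ->]]]]; first exact: rG.
by apply/commgP/eqP/cGr.
Qed.

(** The elements [r c a 0] with [A a] form a subgroup, and commutators lie in it because their third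
    coordinate is 0 and their second is a value of the alternating expression in [f]. *)
Lemma tw_der1_sub (A : pred F) g :
    A 0 -> (forall a a', A a -> A a' -> A (a + a')) ->
    (forall b b', A (f b' * b - f b * b')) ->
  g \in G^`(1)%g -> exists c a, g = r c a 0 /\ A a.
Proof.
move=> A0 AD Acomm.
pose K := [set g | [exists c, exists a, (g == r c a 0) && A a]].
have inK h : reflect (exists c a, h = r c a 0 /\ A a) (h \in K).
  rewrite inE; apply: (iffP existsP) => [[c /existsP[a /andP[/eqP-> Aa]]] | ].
    by exists c, a.
  by case=> c [a [-> Aa]]; exists c; apply/existsP; exists a; rewrite eqxx.
have groupK : group_set K.
  apply/group_setP; split; first by apply/inK; exists 0, 0; rewrite tw1.
  move=> _ _ /inK[c [a [-> Aa]]] /inK[c' [a' [-> Aa']]]; apply/inK.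
  exists (c + c'), (a + a'); split; last exact: AD.
  by rewrite rM twist0; congr r; ring.
move=> Gg; apply/inK; apply: (subsetP _ _ Gg).
rewrite -[K]/(gval (Group groupK)) derg1 gen_subG.
apply/subsetP=> _ /imset2P[_ _ /Gr[c [a [b ->]]] /Gr[c' [a' [b' ->]]] ->].
apply/inK; rewrite tw_comm; eexists; eexists; split; first reflexivity.
exact: Acomm.
Qed.

(** * Exponents *)

Lemma tw_exponent_untwisted p :
  (forall b, f b = 0) -> p \in [pchar F] -> exponent G = p.
Proof.
move=> f0 pcharFp; have p_pr := pcharf_prime pcharFp.
have expGp : (exponent G %| p)%N.
  apply/exponentP=> _ /Gr[c [a [b ->]]].
  rewrite twX f0 -tw1.
  by congr r; rewrite !(mulrn_pchar pcharFp) ?mul0r ?mul0rn ?addr0.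
case/primeP: p_pr => _ /(_ _ expGp)/pred2P[] // expG1.
have /exponentP/(_ _ (rG 1 0 0)) : (exponent G %| 1)%N by rewrite expG1.
by rewrite expg1 => /tw_eq1[/eqP]; rewrite oner_eq0.
Qed.

(** For [p] equal to 2 or 3, ['C(p.+1, 3)] is 1 modulo [p], so the [p]-th power of [r c a b] has
    first coordinate [f b * b * b]. Its third coordinate is 0, so raising to the power [p] once more
    gives 1. *)
Lemma tw_exponent_small p b0 : (p == 2) || (p == 3) -> p \in [pchar F] ->
  f b0 != 0 -> exponent G = (p ^ 2)%N.
Proof.
move=> p23 pcharFp fb0; have p_pr := pcharf_prime pcharFp.
have b0_neq0 : b0 != 0 by apply: contraNneq fb0 => ->; rewrite twist0.
have twXp c a b : exists a', (r c a b ^+ p)%g = r (f b * b * b) a' 0.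
  case/orP: p23 => /eqP p_eq; move: pcharFp; rewrite p_eq => pcharF.
  - exists (f b * b); rewrite twX.
    by congr r; rewrite !(mulrn_pchar pcharF) ?mulr1n ?add0r.
  - exists 0; rewrite twX.
    have -> : 'C(4, 3) = 4 by [].
    have -> : 'C(3, 2) = 3 by [].
    by congr r; rewrite ?[_ *+ 4]mulrS !(mulrn_pchar pcharF) ?addr0 ?add0r.
have expG : (exponent G %| p ^ 2)%N.
  apply/exponentP=> _ /Gr[c [a [b ->]]].
  rewrite expgM; have [a' ->] := twXp c a b.
  rewrite twX twist0 -tw1.
  by congr r; rewrite !(mulrn_pchar pcharFp) ?mul0r ?mul0rn ?addr0.
have /(dvdn_pfactor _ 2 p_pr)[m le_m2 Em] := expG.
rewrite Em; have [-> // | neq_m2] := eqVneq m 2.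
have le_m1 : (m <= 1)%N by rewrite -ltnS ltn_neqAle neq_m2.
have /exponentP/(_ _ (rG 0 0 b0)) : (exponent G %| p)%N.
  by rewrite Em; apply: (dvdn_exp2l p le_m1).
have [a' ->] := twXp 0 0 b0; case/tw_eq1=> /eqP.
by rewrite !mulf_eq0 (negPf fb0) (negPf b0_neq0).
Qed.

Lemma tw_abelem_untwisted :
  (forall b, f b = 0) -> 2 \in [pchar F] -> 2.-abelem G.
Proof.
move=> f0 char2.
rewrite abelemE // (tw_exponent_untwisted f0 char2) dvdnn andbT.
apply/centsP=> _ /Gr[c [a [b ->]]] _ /Gr[c' [a' [b' ->]]].
apply/commgP/eqP; rewrite tw_comm !f0 -tw1 (pcharf0 char2).
by congr r; ring.
Qed.

(** * Centres, commutators and derived subgroups *)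

Lemma tw_center_even c a : 2 \in [pchar F] -> r c a 0 \in 'Z(G).
Proof.
move=> char2; apply/tw_centerP=> c' a' b'.
rewrite tw_comm twist0 (pcharf0 char2) -tw1.
by congr r; ring.
Qed.

(* [A] is an upper bound for the second coordinates of the elements of G'. *)
Lemma tw_der1_proper_even (A : pred F) a0 : 2 \in [pchar F] ->
    A 0 -> (forall a a', A a -> A a' -> A (a + a')) ->
    (forall b b', A (f b' * b - f b * b')) -> ~~ A a0 ->
  (G^`(1) \proper 'Z(G))%g.
Proof.
move=> char2 A0 AD Acomm Aa0; have G'sub := tw_der1_sub A0 AD Acomm.
apply/properP; split.
  by apply/subsetP=> g /G'sub[c [a [-> _]]]; apply: tw_center_even.
exists (r 0 a0 0); first exact: tw_center_even.
by apply: contra Aa0 => /G'sub[c [a [/r_inj[_ -> _]]]].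
Qed.

Lemma tw_nonabelian b b' :
  (f b' * b - f b * b' != 0) || (b * b' * (f b' - f b) != 0) -> ~~ abelian G.
Proof.
apply: contraL => /centsP cGG.
have := cGG _ (rG 0 0 b) _ (rG 0 0 b') => /commgP/eqP.
rewrite tw_comm => /tw_eq1[e1 e2 _]; move: e1; rewrite e2 eqxx /=.
by rewrite !(mul0r, subrr, mulr0, add0r, addr0, oppr0) => ->; rewrite eqxx.
Qed.

Lemma tw_center_odd g : (2%:R : F) != 0 ->
  (g \in 'Z(G)) <-> exists c, g = r c 0 0.
Proof.
move=> nz2; split=> [Zg | [c ->]].
  have [c [a [b Eg]]] := Gr (subsetP (center_sub _) _ Zg).
  move: Zg; rewrite Eg => /tw_centerP Zg.
  (* Commuting with [r 0 1 0] forces [2b = 0]; commuting with [r 0 0 1] then forces [2a = 0]. *)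
  have [] := tw_eq1 (etrans (esym (tw_comm c a b 0 1 0)) (Zg 0 1 0)).
  rewrite twist0.
  rewrite !(mul0r, mulr0, oppr0, subr0, addr0, add0r, sub0r, mul1r, mulrN).
  move/eqP; rewrite oppr_eq0 mulf_eq0 (negPf nz2) => /eqP b0 _ _.
  have [] := tw_eq1 (etrans (esym (tw_comm c a b 0 0 1)) (Zg 0 0 1)).
  rewrite b0 twist0 !(mul0r, mulr0, oppr0, subr0, addr0, add0r, sub0r, mulr1).
  move/eqP; rewrite mulf_eq0 (negPf nz2) => /eqP a0 _ _.
  by exists c; rewrite a0.
apply/tw_centerP=> c' a' b'; rewrite tw_comm twist0 -tw1.
by congr r; ring.
Qed.

Lemma tw_center_sub_der1_odd : (2%:R : F) != 0 -> ('Z(G) \subset G^`(1))%g.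
Proof.
move=> nz2; apply/subsetP=> g /(tw_center_odd _ nz2)[c ->].
have -> : r c 0 0 = [~ r 0 (c / 2%:R) 0, r 0 0 1].
  rewrite tw_comm twist0; congr r; first by field.
  by ring.
exact/mem_commg/rG/rG.
Qed.

(** The commutator of [r 0 0 b] and [r 0 0 b'] has nonzero second coordinate, hence is not
    central. *)
Lemma tw_center_proper_odd b b' : (2%:R : F) != 0 ->
  f b' * b - f b * b' != 0 -> ('Z(G) \proper G^`(1))%g.
Proof.
move=> nz2 ncomm; apply/properP; split; first exact: tw_center_sub_der1_odd.
exists [~ r 0 0 b, r 0 0 b']; first exact/mem_commg/rG/rG.
rewrite tw_comm; apply/negP=> /(tw_center_odd _ nz2)[c /r_inj[_ /eqP]].
by rewrite (negPf ncomm).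
Qed.

Section ScalarTwist.

(** Taking [b' = 1] shows that [f] is multiplication by [f 1]; the twists 0 and [id] are of this
    kind. *)
Hypothesis scalf : forall b b', f b' * b = f b * b'.

Lemma tw_der1_scalar g : g \in G^`(1)%g -> exists c, g = r c 0 0.
Proof.
case/(@tw_der1_sub (pred1 0)) => /=
  [|a a' /eqP-> /eqP->|b b'|c [a [-> /eqP->]]].
- exact: eqxx.
- by rewrite addr0.
- by rewrite scalf subrr.
- by exists c.
Qed.

Lemma tw_center_scalar_odd : (2%:R : F) != 0 -> 'Z(G) = G^`(1)%g.
Proof.
move=> nz2; apply/eqP; rewrite eqEsubset tw_center_sub_der1_odd //.
by apply/subsetP=> g /tw_der1_scalar /(tw_center_odd _ nz2).
Qed.

(** The Frattini subgroup of a [p]-group is generated by [G'] and the [p]-th powers. These powers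
    are central: [p] divides ['C(p, 2)], so only the first coordinate can survive. *)
Lemma tw_special_odd p : odd p -> p \in [pchar F] -> p.-group G -> special G.
Proof.
move=> odd_p pcharFp pG; have p_pr := pcharf_prime pcharFp.
have nz2 : (2%:R : F) != 0.
  rewrite -(dvdn_pcharf pcharFp) dvdn_prime2 //.
  by apply: contraTneq odd_p => ->.
have ZG' := tw_center_scalar_odd nz2.
split; last by [].
rewrite (Phi_joing pG) -ZG'; apply/joing_idPl.
rewrite (MhoE 1 pG) gen_subG; apply/subsetP=> _ /imsetP[_ /Gr[c [a [b ->]]] ->].
apply/(tw_center_odd _ nz2); eexists; rewrite expn1 twX.
have p2 : (p %| 'C(p, 2))%N.
  by rewrite prime_dvd_bin // odd_prime_gt2.
congr r; rewrite ?(mulrn_pchar pcharFp) // add0r.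
by case/dvdnP: p2 => k ->; rewrite mulnC mulrnA (mulrn_pchar pcharFp) mul0rn.
Qed.

End ScalarTwist.

(** The square of [r c a b] has second coordinate [f b * b], which vanishes only for [b = 0] when
    [f] has trivial kernel. *)
Lemma tw_involution_central : 2 \in [pchar F] ->
    (forall b, f b = 0 -> b = 0) ->
  {in G, forall g, (g ^+ 2 = 1)%g -> g \in 'Z(G)}.
Proof.
move=> char2 injf _ /Gr[c [a [b ->]]]; rewrite twX => /tw_eq1[_ + _].
rewrite (mulrn_pchar char2) add0r => /eqP; rewrite mulf_eq0.
have [-> _|nzb /orP[/eqP/injf b0|//]] := eqVneq b 0.
  exact: tw_center_even.
by rewrite b0 eqxx in nzb.
Qed.

(** For [b] in the kernel of [f], [r 0 0 b] squares to 1, but its commutator with [r 0 0 b'] has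
    second coordinate [f b' * b]. *)
Lemma tw_involution_noncentral b b' : 2 \in [pchar F] ->
  b != 0 -> f b = 0 -> f b' != 0 ->
  exists2 g, g \in G & (g ^+ 2 = 1)%g /\ g \notin 'Z(G).
Proof.
move=> char2 nzb fb fb'; exists (r 0 0 b); first exact: rG.
split.
  rewrite twX fb -tw1.
  by congr r; rewrite !(mulrn_pchar char2) ?mul0r ?mul0rn ?addr0.
apply/negP=> /tw_centerP/(_ 0 0 b').
rewrite tw_comm => /tw_eq1[_ /eqP + _].
by rewrite fb mul0r subr0 mulf_eq0 (negPf fb') (negPf nzb).
Qed.

End Theory.

(* Solving for a coboundary turns the cocycle of the twist [id] into that of
   the untwisted group, at the price of dividing by 6. *)
Lemma tw_id_isog (gT1 gT2 : finGroupType) (G1 : {group gT1}) (G2 : {group gT2})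
    r1 r2 :
    twisted_heisenberg (fun=> 0) G1 r1 -> twisted_heisenberg id G2 r2 ->
  6%:R != 0 :> F -> (G1 \isog G2)%g.
Proof.
move=> tw1 tw2 nz6; rewrite isog_sym.
(* The coboundary of [b ^+ 2 / 2] is [b * b'], the extra term of the second coordinate; [b ^+ 3 / 6]
   absorbs what then remains in the first. *)
pose h (t : F * F * F) :=
  r1 (t.1.1 - t.2 ^+ 3 / 6%:R) (t.1.2 - t.2 ^+ 2 / 2%:R) t.2.
(* The [pick] recovers the coordinates of an element of [G2]; the default 1 is taken only outside
   [G2]. *)
pose phi g := oapp h 1%g [pick t | g == r2 t.1.1 t.1.2 t.2].
have phiE c a b : phi (r2 c a b) = h (c, a, b).
  rewrite /phi; case: pickP => [[[c' a'] b'] /= | /(_ (c, a, b))]; last first.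
    by rewrite eqxx.
  by move/eqP/(tw_inj tw2)=> [-> -> ->].
have nz2 : 2%:R != 0 :> F.
  by apply: contraNneq nz6 => z2; rewrite (natrM F 2 3) z2 mul0r.
have phiM : {in G2 &, {morph phi : g g' / (g * g')%g}}.
  move=> _ _ /(twE tw2)[c [a [b ->]]] /(twE tw2)[c' [a' [b' ->]]].
  rewrite (twM tw2) !phiE /h /= (twM tw1); congr r1; field.
    by rewrite nz6 nz2.
  by [].
apply/isogP; exists (Morphism phiM).
  apply/injmP=> _ _ /(twE tw2)[c [a [b ->]]] /(twE tw2)[c' [a' [b' ->]]] /=.
  rewrite !phiE /h /= => /(tw_inj tw1)[+ + Eb]; rewrite Eb.
  by move=> /addIr-> /addIr->.
apply/eqP; rewrite eqEsubset; apply/andP; split.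
  apply/subsetP=> _ /morphimP[_ _ /(twE tw2)[c [a [b ->]]] ->] /=.
  by rewrite phiE; apply: twG tw1 _ _ _.
apply/subsetP=> _ /(twE tw1)[c [a [b ->]]].
have -> : r1 c a b =
    Morphism phiM (r2 (c + b ^+ 3 / 6%:R) (a + b ^+ 2 / 2%:R) b).
  by rewrite /= phiE /h /= !addrK.
by apply/mem_morphim/twG/tw2; apply: twG tw2 _ _ _.
Qed.

End TwistedHeisenberg.

(** * Isomorphism invariants and the order of the twisted groups *)

Lemma isog_center_der1 (gT1 gT2 : finGroupType) (G1 : {group gT1})
    (G2 : {group gT2}) :
  G1 \isog G2 -> 'Z(G1) = G1^`(1) -> 'Z(G2) = G2^`(1).
Proof.
case/isogP=> phi injphi <- ZG1.
by rewrite -(injm_center injphi) // ZG1 morphim_der.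
Qed.

Lemma isog_involution_central (gT1 gT2 : finGroupType) (G1 : {group gT1})
    (G2 : {group gT2}) :
    G1 \isog G2 -> {in G1, forall g, g ^+ 2 = 1 -> g \in 'Z(G1)} ->
  {in G2, forall g, g ^+ 2 = 1 -> g \in 'Z(G2)}.
Proof.
case/isogP=> phi injphi <- G1inv _ /morphimP[g _ Gg ->].
rewrite -morphX // => /eqP; rewrite morph_injm_eq1 ?groupX // => /eqP g2.
have Zg := G1inv g Gg g2.
by rewrite -(injm_center injphi) ?subxx ?mem_morphim.
Qed.

Lemma tw_pgroup (F : finFieldType) f (gT : finGroupType) (G : {group gT}) r
    p n :
  @twisted_heisenberg F f gT G r -> prime p -> #|F| = (p ^ n)%N -> p.-group G.
Proof.
move=> tw p_pr cardF.
have -> : G :=: [set r t.1.1 t.1.2 t.2 | t : F * F * F].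
  apply/setP=> g; apply/idP/imsetP => [/(twE tw)[c [a [b ->]]] | [t _ ->]].
    by exists (c, a, b).
  exact: twG tw _ _ _.
rewrite /pgroup card_imset.
  by rewrite !card_prod cardF -!expnD pnatX pnat_id.
by move=> [[c a] b] [[c' a'] b'] /(tw_inj tw)[/= -> -> ->].
Qed.

(** * The absolute trace *)

Section AbsoluteTrace.

Local Open Scope ring_scope.

Variables (F : finFieldType) (p n : nat).
Hypotheses (pcharFp : p \in [pchar F]) (cardF : #|F| = (p ^ n)%N).
Hypothesis n_gt1 : (1 < n)%N.

Definition abs_trace (b : F) : F := \sum_(i < n) b ^+ (p ^ i).

Let p_pr : prime p := pcharf_prime pcharFp.

Lemma abs_traceD : {morph abs_trace : x y / x + y}.
Proof.
move=> x y; rewrite -big_split; apply: eq_bigr => i _ /=.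
by rewrite exprDn_pchar // (eq_pnat _ (pcharf_eq pcharFp)) pnatX pnat_id.
Qed.

Lemma abs_trace_Frobenius b : abs_trace b ^+ p = abs_trace (b ^+ p).
Proof.
rewrite -(pFrobenius_autE pcharFp) rmorph_sum; apply: eq_bigr => i _ /=.
by rewrite pFrobenius_autE exprAC.
Qed.

(** Raising to the power [p] permutes the summands cyclically, since [b ^+ (p ^ n) = b]. *)
Lemma abs_trace_fixed b : abs_trace (b ^+ p) = abs_trace b.
Proof.
have : b ^+ (p ^ n) = b by rewrite -cardF expf_card.
rewrite /abs_trace; case: n => [|m] bE; first by rewrite !big_ord0.
rewrite big_ord_recr big_ord_recl /= -exprM -expnS bE expn0 expr1 addrC.
by congr (_ + _); apply: eq_bigr => i _; rewrite -exprM -expnS.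
Qed.

(** The condition on [k] says that it lies in the prime field, so every iterate of Frobenius fixes
    it. *)
Lemma abs_traceZ k b : k ^+ p = k -> abs_trace (k * b) = k * abs_trace b.
Proof.
move=> kp; have kX i : k ^+ (p ^ i) = k.
  by elim: i => [|i IHi]; rewrite ?expr1 // expnS exprM kp.
by rewrite /abs_trace mulr_sumr; apply: eq_bigr => i _; rewrite exprMn kX.
Qed.

(** The trace is a polynomial function of degree [p ^ n.-1], too small for all elements of [F] to be
    roots. *)
Lemma abs_trace_neq0 : exists b, abs_trace b != 0.
Proof.
have [m nE] : exists m, n = m.+2 by case: n n_gt1 => [|[|m]] // _; exists m.
pose T : {poly F} := \sum_(i < n) 'X^(p ^ i).
have sizeT : size T = (p ^ m.+1).+1.
  rewrite /T nE big_ord_recr /= addrC size_polyDl size_polyXn //.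
  rewrite ltnS (leq_trans (size_sum _ _ _)) //; apply/bigmax_leqP=> i _.
  by rewrite size_polyXn ltn_exp2l ?prime_gt1.
apply/existsP; rewrite -negb_forall; apply: contraTN isT => /forallP T0.
have nzT : T != 0 by rewrite -size_poly_gt0 sizeT.
have rootT : all (root T) (enum F).
  apply/allP=> b _; rewrite /root /T horner_sum.
  by under eq_bigr do rewrite hornerXn; apply: T0.
have := max_poly_roots nzT rootT (enum_uniq _).
by rewrite -cardE cardF sizeT nE ltnS leq_exp2l ?prime_gt1 // ltnn.
Qed.

(** Elements [y ^+ p - y] have trace 0. One of them is nonzero because ['X^p - 'X] has at most [p]
    roots, fewer than [F] has elements. *)
Lemma abs_trace_kernel : exists2 b, b != 0 & abs_trace b = 0.
Proof.
have [y yp] : exists y : F, y ^+ p - y != 0.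
  apply/existsP; rewrite -negb_forall; apply: contraTN isT => /forallP yp.
  pose T : {poly F} := 'X^p - 'X.
  have sizeT : size T = p.+1.
    by rewrite size_polyDl size_polyXn // size_polyN size_polyX ltnS prime_gt1.
  have nzT : T != 0 by rewrite -size_poly_gt0 sizeT.
  have rootT : all (root T) (enum F).
    by apply/allP=> y _; rewrite /root hornerD hornerN hornerXn hornerX yp.
  have := max_poly_roots nzT rootT (enum_uniq _).
  rewrite -cardE cardF sizeT ltnS -[X in (_ <= X)%N](expn1 p).
  by rewrite leq_exp2l ?prime_gt1 // leqNgt n_gt1.
exists (y ^+ p - y) => //.
apply: (addIr (abs_trace y)).
by rewrite -abs_traceD subrK abs_trace_fixed add0r.
Qed.

End AbsoluteTrace.

(** * Automorphisms of a geometry and of its Payne derivation *)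

Section GeometryAutomorphisms.

Variables (T : finType) (lines : {set {set T}}).

Lemma Aut_geom_line (g : {perm T}) (L : {set T}) : g \in Aut_geom lines ->
  (g @: L \in lines) = (L \in lines).
Proof. by move=> Ag; apply: (astabs_act L Ag). Qed.

Lemma Aut_geomP (g : {perm T}) :
  {in lines, forall L : {set T}, g @: L \in lines} -> g \in Aut_geom lines.
Proof.
move=> glines; rewrite !inE; apply/subsetP=> L Ll.
rewrite inE; exact: glines.
Qed.

Lemma Aut_geom_collinear (g : {perm T}) y z : g \in Aut_geom lines ->
  collinear lines (g y) (g z) = collinear lines y z.
Proof.
have imp h u v : h \in Aut_geom lines ->
    collinear lines u v -> collinear lines (h u) (h v).
  move=> Ah /existsP[L /and3P[Ll uL vL]]; apply/existsP; exists (h @: L).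
  by rewrite Aut_geom_line // Ll !imset_f.
move=> Ag; apply/idP/idP; last exact: imp.
by move/(imp g^-1 _ _); rewrite !permK groupV; apply.
Qed.

Lemma Aut_geom_perp (g : {perm T}) (A : {set T}) : g \in Aut_geom lines ->
  perp lines (g @: A) = g @: perp lines A.
Proof.
move=> Ag; apply/setP=> z; rewrite -{1 2}(permKV g z).
rewrite (mem_imset _ _ (@perm_inj _ g)) !inE.
apply/forall_inP/forall_inP => zA y yA.
  by rewrite -(Aut_geom_collinear _ _ Ag) zA ?imset_f.
by case/imsetP: yA => {}y yA ->; rewrite Aut_geom_collinear ?zA.
Qed.

End GeometryAutomorphisms.

Section PayneAction.

Variables (T : finType) (lines : {set {set T}}) (x : T).

Lemma stab_geomP (g : {perm T}) :
  reflect (g \in Aut_geom lines /\ g x = x) (g \in stab_geom lines x).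
Proof.
apply: (iffP setIP) => -[Ag gx]; split=> //; first by move/astab1P: gx.
exact/astab1P.
Qed.

Lemma stab_geom_acts : stab_geom lines x \subset
  subact_dom (fun y => ~~ collinear lines x y) ('P).
Proof.
apply/subsetP=> g /stab_geomP[Ag gx]; apply/astabsP=> y.
by rewrite !inE /= apermE -{1}gx Aut_geom_collinear.
Qed.

Definition payne_act : {perm T} -> {perm payne_point lines x} := actperm ('P^?).

Lemma val_payne_act g y : g \in stab_geom lines x ->
  val (payne_act g y) = g (val y).
Proof.
by move/(subsetP stab_geom_acts)=> gd; rewrite actpermE val_subact gd.
Qed.

Lemma payne_actM : {in stab_geom lines x &, {morph payne_act : g h / g * h}}.
Proof.
move=> g h sg sh; apply/permP=> y; apply: val_inj.
by rewrite permM !val_payne_act ?groupM // permM.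
Qed.

Lemma payne_restrE (G : {set {perm T}}) : G \subset stab_geom lines x ->
  payne_restr lines x G = payne_act @: G.
Proof.
by move=> sG; apply: morphimEsub; apply: subset_trans sG stab_geom_acts.
Qed.

(** An automorphism fixing [x] permutes the lines not through [x], and it commutes with [perp], so
    both kinds of derived lines are preserved. *)
Lemma payne_act_Aut g : g \in stab_geom lines x ->
  payne_act g \in Aut_geom (payne_lines lines x).
Proof.
move=> sg; have /stab_geomP[Ag gx] := sg.
have im_pre (L : {set T}) :
    payne_act g @: (val @^-1: L) = val @^-1: (g @: L)
      :> {set payne_point lines x}.
  apply/setP=> y; rewrite -(permKV (payne_act g) y).
  rewrite (mem_imset _ _ (@perm_inj _ _)) !inE val_payne_act //.
  by rewrite (mem_imset _ _ (@perm_inj _ _)).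
apply: Aut_geomP => K; rewrite in_setU => /orP[] /imsetP[L].
  rewrite inE => /andP[Ll xL] ->; rewrite im_pre; apply/setUP; left.
  apply: imset_f; rewrite inE Aut_geom_line // Ll -gx.
  by rewrite (mem_imset _ _ (@perm_inj _ g)).
move=> _ ->; rewrite im_pre; apply/setUP; right; apply/imsetP.
exists (payne_act g L) => //; congr (_ @^-1: _).
have imD1 (A : {set T}) : g @: (A :\ x) = (g @: A) :\ x.
  apply/setP=> z; rewrite -(permKV g z) (mem_imset _ _ (@perm_inj _ _)) !inE.
  by rewrite (mem_imset _ _ (@perm_inj _ _)) -{2}gx (inj_eq (@perm_inj _ g)).
by rewrite imD1 val_payne_act // -!Aut_geom_perp // imsetU1 imset_set1 gx.
Qed.

End PayneAction.

(** * Symplectic frames and the points of W(3,q) *)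

Section SymplecticFrames.

Local Open Scope ring_scope.

Variables (F : finFieldType) (B : {biscalar 'rV[F]_4}).
Hypotheses (altB : alternating_form B) (ndB : nondegenerate_form B).

Lemma formDl u v w : B (u + v) w = B u w + B v w.
Proof. exact: linearDl. Qed.

Lemma formDr u v w : B w (u + v) = B w u + B w v.
Proof. exact: linearDr. Qed.

Lemma formZl a u w : B (a *: u) w = a * B u w.
Proof. exact: linearZl_LR. Qed.

Lemma formZr a u w : B w (a *: u) = a * B w u.
Proof. exact: linearZr_LR. Qed.

Lemma formC u v : B u v = - B v u.
Proof.
apply/eqP; rewrite -addr_eq0; have := altB (u + v).
by rewrite formDl !formDr !altB add0r addr0 => ->.
Qed.

Lemma form_neq0 u : u != 0 -> exists v, B u v != 0.
Proof.
move=> nzu; apply/existsP; rewrite -negb_forall; apply: contraNN nzu.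
by move=> /forallP Bu0; apply/eqP/ndB => v; apply/eqP/Bu0.
Qed.

(** Two mutually orthogonal hyperbolic pairs, [(e0, e3)] and [(e2, e1)]; the other values of [B]
    follow since it is alternating. *)
Record symplectic_frame (e0 e1 e2 e3 : 'rV[F]_4) : Prop := SymplecticFrame {
  form03 : B e0 e3 = 1;
  form01 : B e0 e1 = 0;
  form02 : B e0 e2 = 0;
  form13 : B e1 e3 = 0;
  form23 : B e2 e3 = 0;
  form21 : B e2 e1 = 1
}.

Definition frame_vec (e0 e1 e2 e3 : 'rV[F]_4) (x0 x1 x2 x3 : F) :=
  x0 *: e0 + x1 *: e1 + x2 *: e2 + x3 *: e3.

Lemma symplectic_frameP u : u != 0 ->
  exists e1 e2 e3, symplectic_frame u e1 e2 e3.
Proof.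
move=> nzu; have [e3 Bu3] : exists e3, B u e3 = 1.
  have [w Buw] := form_neq0 nzu.
  by exists ((B u w)^-1 *: w); rewrite formZr mulVf.
have B3u : B e3 u = -1 by rewrite formC Bu3.
(* [pr] is the projection onto the orthogonal complement of the hyperbolic plane spanned by [u] and
   [e3]. *)
pose pr v := v + (- B v e3) *: u + (- B u v) *: e3.
have Bupr v : B u (pr v) = 0.
  by rewrite /pr !formDr !formZr altB Bu3; ring.
have Bpr3 v : B (pr v) e3 = 0.
  by rewrite /pr !formDl !formZl altB Bu3; ring.
have [e1 [nz1 B01 B13]] : exists e1, [/\ e1 != 0, B u e1 = 0 & B e1 e3 = 0].
  suff /existsP[v nzv] : [exists v, pr v != 0] by exists (pr v).
  (* If every projection vanished, [u] and [e3] would span a space of dimension 4. *)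
  rewrite -negb_forall; apply: contraTN isT => /forallP pr0.
  have : (fullv <= <<[:: u; e3]>>)%VS.
    apply/subvP=> v _.
    have -> : v = B v e3 *: u + B u v *: e3.
      have /eqP := pr0 v; rewrite /pr !scaleNr -addrA -opprD => /eqP.
      by rewrite subr_eq0 => /eqP.
    by rewrite rpredD ?rpredZ ?memv_span ?inE ?eqxx ?orbT.
  move/dimvS; rewrite dimvf => /leq_trans/(_ (dim_span _)).
  by rewrite dim_matrix.
have [w Bw1] : exists w, B w e1 = 1.
  have [w B1w] := form_neq0 nz1.
  by exists ((- B e1 w)^-1 *: w); rewrite formZl (formC w) mulVf ?oppr_eq0.
exists e1, (pr w), e3; split=> //.
by rewrite /pr !formDl !formZl B01 Bw1 (formC e3) B13; ring.
Qed.

Section Coordinates.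

Variables e0 e1 e2 e3 : 'rV[F]_4.
Hypothesis fr : symplectic_frame e0 e1 e2 e3.

Local Notation vec := (frame_vec e0 e1 e2 e3).

Lemma form_frame : (B e0 e0 = 0) * (B e1 e1 = 0) * (B e2 e2 = 0) * (B e3 e3 = 0)
  * (B e0 e1 = 0) * (B e0 e2 = 0) * (B e0 e3 = 1) * (B e1 e0 = 0)
  * (B e1 e2 = -1) * (B e1 e3 = 0) * (B e2 e0 = 0) * (B e2 e1 = 1)
  * (B e2 e3 = 0) * (B e3 e0 = -1) * (B e3 e1 = 0) * (B e3 e2 = 0).
Proof.
case: fr => b03 b01 b02 b13 b23 b21.
rewrite !altB (formC e1 e0) (formC e1 e2) (formC e2 e0) (formC e3 e0).
by rewrite (formC e3 e1) (formC e3 e2) b03 b01 b02 b13 b23 b21 !oppr0.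
Qed.

Lemma form_vec x0 x1 x2 x3 y0 y1 y2 y3 :
  B (vec x0 x1 x2 x3) (vec y0 y1 y2 y3) = x0 * y3 - x3 * y0 - x1 * y2 + x2 * y1.
Proof.
by rewrite /frame_vec !formDl !formDr !formZl !formZr !form_frame; ring.
Qed.

Lemma coord0_vec x0 x1 x2 x3 : B (vec x0 x1 x2 x3) e3 = x0.
Proof. by rewrite /frame_vec !formDl !formZl !form_frame; ring. Qed.

Lemma coord1_vec x0 x1 x2 x3 : B e2 (vec x0 x1 x2 x3) = x1.
Proof. by rewrite /frame_vec !formDr !formZr !form_frame; ring. Qed.

Lemma coord2_vec x0 x1 x2 x3 : B (vec x0 x1 x2 x3) e1 = x2.
Proof. by rewrite /frame_vec !formDl !formZl !form_frame; ring. Qed.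

Lemma coord3_vec x0 x1 x2 x3 : B e0 (vec x0 x1 x2 x3) = x3.
Proof. by rewrite /frame_vec !formDr !formZr !form_frame; ring. Qed.

Definition coord_vec := (coord0_vec, coord1_vec, coord2_vec, coord3_vec).

Lemma vec_inj x0 x1 x2 x3 y0 y1 y2 y3 :
  vec x0 x1 x2 x3 = vec y0 y1 y2 y3 -> [/\ x0 = y0, x1 = y1, x2 = y2 & x3 = y3].
Proof.
move=> eq_v; split.
- by rewrite -(coord0_vec x0 x1 x2 x3) eq_v coord_vec.
- by rewrite -(coord1_vec x0 x1 x2 x3) eq_v coord_vec.
- by rewrite -(coord2_vec x0 x1 x2 x3) eq_v coord_vec.
- by rewrite -(coord3_vec x0 x1 x2 x3) eq_v coord_vec.
Qed.

(** The map from coordinates to vectors is injective between sets of equal size, hence onto; the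
    form then reads off the coordinates. *)
Lemma vec_coord v : v = vec (B v e3) (B e2 v) (B v e1) (B e0 v).
Proof.
pose h (t : F * F * F * F) := vec t.1.1.1 t.1.1.2 t.1.2 t.2.
have /inj_card_bij[| g _ hK] : injective h;
  last by rewrite -[v]hK /h !coord_vec.
  by move=> [[[x0 x1] x2] x3] [[[y0 y1] y2] y3] /vec_inj /= [-> -> -> ->].
by rewrite card_mx !card_prod !expnS muln1 !mulnA.
Qed.

Lemma vecZ k x0 x1 x2 x3 :
  k *: vec x0 x1 x2 x3 = vec (k * x0) (k * x1) (k * x2) (k * x3).
Proof. by rewrite /frame_vec !scalerDr !scalerA. Qed.

Lemma vecD x0 x1 x2 x3 y0 y1 y2 y3 :
  vec x0 x1 x2 x3 + vec y0 y1 y2 y3 =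
    vec (x0 + y0) (x1 + y1) (x2 + y2) (x3 + y3).
Proof.
rewrite /frame_vec addrACA [X in X + _]addrACA [X in X + _ + _]addrACA.
by rewrite !scalerDl.
Qed.

End Coordinates.

End SymplecticFrames.

Section SymplecticPoints.

Local Open Scope ring_scope.

Variables (F : finFieldType) (B : {biscalar 'rV[F]_4}).
Hypotheses (altB : alternating_form B) (ndB : nondegenerate_form B).

Lemma W_pointE (y : W_point F) : exists2 v, v != 0 & val y = <[v]>%VS.
Proof.
case: y => U /= dimU; exists (vpick U).
  by rewrite vpick0 -dimv_eq0 (eqP dimU).
apply/esym/eqP; rewrite eqEdim (eqP dimU) dim_vline vpick0 -dimv_eq0 (eqP dimU).
by rewrite andbT -memvE memv_pick.
Qed.

Fact point_subproof v : v != 0 -> \dim (<[v]> : {vspace 'rV[F]_4}) == 1%N.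
Proof. by rewrite dim_vline => ->. Qed.

Definition point v (nzv : v != 0) : W_point F :=
  Sub <[v]>%VS (point_subproof nzv).

Lemma val_point v (nzv : v != 0) : val (point nzv) = <[v]>%VS.
Proof. by []. Qed.

Lemma isotropic_line u v : u != 0 -> v \notin <[u]>%VS -> B u v = 0 ->
  (\dim (<[u]> + <[v]>)%VS == 2) && totally_isotropic B (<[u]> + <[v]>)%VS.
Proof.
move=> nzu uv Buv; apply/andP; split.
  have nzv : v != 0 by apply: contraNneq uv => ->; rewrite mem0v.
  rewrite dimv_disjoint_sum ?dim_vline ?nzu ?nzv //.
  apply/eqP; rewrite -subv0; apply/subvP=> w; rewrite memv_cap memv0.
  case/andP=> /vlineP[k ->] /vlineP[l Ekl]; rewrite Ekl.
  have [-> | nzl] := eqVneq l 0; first by rewrite scale0r.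
  case/negP: uv; apply/vlineP; exists (l^-1 * k).
  by rewrite -scalerA Ekl scalerA mulVf // scale1r.
have Bvu : B v u = 0 by rewrite formC // Buv oppr0.
apply/forall_inP=> _ /memv_addP[_ /vlineP[k ->] [_ /vlineP[l ->] ->]].
apply/forall_inP=> _ /memv_addP[_ /vlineP[k' ->] [_ /vlineP[l' ->] ->]].
rewrite !formDl !formDr !formZl !formZr !altB Buv Bvu.
by apply/eqP; ring.
Qed.

Lemma collinearE (y z : W_point F) u v :
  val y = <[u]>%VS -> val z = <[v]>%VS ->
  collinear (W_lines B) y z = (B u v == 0).
Proof.
move=> yE zE; have nzu : u != 0.
  by have := valP y; rewrite yE dim_vline; case: (u != 0).
apply/existsP/eqP => [[_ /andP[/imsetP[U + ->]]] | Buv].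
  rewrite inE => /andP[_ /forall_inP isoU]; rewrite !inE yE zE -!memvE.
  by case/andP=> uU vU; have /forall_inP/(_ v vU)/eqP := isoU u uU.
have [w uw /andP[Buw zw]] : exists2 w, w \notin <[u]>%VS &
    (B u w == 0) && (v \in (<[u]> + <[w]>)%VS).
  have [vu | uv] := boolP (v \in <[u]>%VS); last first.
    by exists v => //; rewrite Buv eqxx (subvP (addvSr _ _)) ?memv_line.
  have [e1 [e2 [e3 fr]]] := symplectic_frameP altB ndB nzu.
  (* When the two points coincide, any totally isotropic line through the point will do; a frame
     starting at [u] provides one. *)
  exists e1; last by rewrite (form01 fr) eqxx (subvP (addvSl _ _)).
  apply/vlineP=> -[k e1E]; have := form21 fr; rewrite e1E formZr formC //.
  by rewrite (form02 fr) oppr0 mulr0 => /esym/eqP; rewrite oner_eq0.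
exists [set y : W_point F | (val y <= <[u]> + <[w]>)%VS].
rewrite !inE yE zE -!memvE zw (subvP (addvSl _ _)) ?memv_line // !andbT.
by apply: imset_f; rewrite inE isotropic_line ?(eqP Buw).
Qed.

Section LinearAction.

Variable phi : 'End('rV[F]_4).
Hypothesis isophi : forall u v, B (phi u) (phi v) = B u v.

(** A vector in the kernel of an isometry is orthogonal to everything. *)
Lemma isometry_inj : lker phi == 0%VS.
Proof.
apply/lker0P=> u v eq_uv; apply/eqP; rewrite -subr_eq0; apply/eqP/ndB => w.
by rewrite -isophi linearB /= eq_uv subrr linear0l.
Qed.

Fact point_img_subproof (y : W_point F) : \dim (phi @: val y)%VS == 1%N.
Proof. by rewrite limg_dim_eq ?(valP y) // (eqP isometry_inj) capv0. Qed.

Definition point_img (y : W_point F) : W_point F :=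
  Sub (phi @: val y)%VS (point_img_subproof y).

Lemma point_img_inj : injective point_img.
Proof.
move=> y z /(congr1 val) /= /eqP; rewrite eqEsubv !(limg_ker0 _ _ isometry_inj).
by rewrite -eqEsubv => /eqP/val_inj.
Qed.

Definition point_perm : {perm W_point F} := perm point_img_inj.

Lemma val_point_perm y : val (point_perm y) = (phi @: val y)%VS.
Proof. by rewrite permE. Qed.

Lemma point_perm_Aut : point_perm \in Aut_geom (W_lines B).
Proof.
apply: Aut_geomP => _ /imsetP[U + ->]; rewrite inE => /andP[dimU isoU].
apply/imsetP; exists (phi @: U)%VS.
  rewrite inE limg_dim_eq ?dimU ?(eqP isometry_inj) ?capv0 //=.
  apply/forall_inP=> _ /memv_imgP[u uU ->].
  apply/forall_inP=> _ /memv_imgP[v vU ->].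
  by rewrite isophi; move/forall_inP/(_ u uU)/forall_inP/(_ v vU): isoU.
apply/setP=> y; rewrite -(permKV point_perm y).
rewrite (mem_imset _ _ (@perm_inj _ _)) !inE val_point_perm.
by rewrite limg_ker0 ?isometry_inj.
Qed.

End LinearAction.

End SymplecticPoints.

(** * The action of the twisted Heisenberg groups *)

Section TwistedAction.

Local Open Scope ring_scope.

Variables (F : finFieldType) (B : {biscalar 'rV[F]_4}).
Hypotheses (altB : alternating_form B) (ndB : nondegenerate_form B).
Variables e0 e1 e2 e3 : 'rV[F]_4.
Hypothesis fr : symplectic_frame B e0 e1 e2 e3.
Variable x : W_point F.
Hypothesis xE : val x = <[e0]>%VS.
Variable f : F -> F.
Hypothesis fD : {morph f : b b' / b + b'}.

Local Notation vec := (frame_vec e0 e1 e2 e3).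
Local Notation lines := (W_lines B).

(** In frame coordinates: first [x1] becomes [x1 + f b * x2], then the Heisenberg element with
    parameters [c], [a], [b] is applied. *)
Definition twist_map c a b (v : 'rV[F]_4) : 'rV[F]_4 :=
  vec (B v e3 + c * B e0 v + b * (B e2 v + f b * B v e1) - a * B v e1)
      (B e2 v + f b * B v e1 + a * B e0 v) (B v e1 + b * B e0 v) (B e0 v).

Fact twist_map_linear c a b : linear (twist_map c a b).
Proof.
move=> k u v; rewrite /twist_map vecZ.
rewrite vecD !(formDl, formDr, formZl, formZr).
by congr (frame_vec _ _ _ _); ring.
Qed.

HB.instance Definition _ c a b :=
  GRing.isLinear.Build F _ _ _ (twist_map c a b) (twist_map_linear c a b).

Lemma twist_map_vec c a b x0 x1 x2 x3 : twist_map c a b (vec x0 x1 x2 x3) =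
  vec (x0 + c * x3 + b * (x1 + f b * x2) - a * x2) (x1 + f b * x2 + a * x3)
    (x2 + b * x3) x3.
Proof. by rewrite /twist_map !(coord_vec altB fr). Qed.

Lemma twist_map_form c a b u v :
  B (linfun (twist_map c a b) u) (linfun (twist_map c a b) v) = B u v.
Proof.
rewrite !lfunE /= (vec_coord altB fr u) (vec_coord altB fr v) !twist_map_vec.
by rewrite !(form_vec altB fr); ring.
Qed.

Definition twist_perm c a b : {perm W_point F} :=
  point_perm ndB (@twist_map_form c a b).

Lemma twist_permE c a b (y : W_point F) v :
  val y = <[v]>%VS -> val (twist_perm c a b y) = <[twist_map c a b v]>%VS.
Proof. by move=> yE; rewrite val_point_perm yE limg_line lfunE. Qed.

Lemma eq_twist_perm c a b c' a' b' :
  c = c' -> a = a' -> b = b' -> twist_perm c a b = twist_perm c' a' b'.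
Proof. by move=> -> -> ->. Qed.

Lemma twist_permM c a b c' a' b' :
  (twist_perm c a b * twist_perm c' a' b')%g =
  twist_perm (c + c' + b' * (a + f b' * b) - a' * b) (a + a' + f b' * b)
    (b + b').
Proof.
apply/permP=> y; apply: val_inj; have [v _ yE] := W_pointE y.
rewrite permM (twist_permE _ _ _ (twist_permE _ _ _ yE)) (twist_permE _ _ _ yE).
rewrite (vec_coord altB fr v) !twist_map_vec fD.
by congr (<[vec _ _ _ _]>%VS); ring.
Qed.

Let f0 : f 0 = 0.
Proof. by apply: (addrI (f 0)); rewrite -fD !addr0. Qed.

Lemma twist_perm_stab c a b : twist_perm c a b \in stab_geom lines x.
Proof.
apply/stab_geomP; split; first exact: point_perm_Aut.
apply: val_inj; rewrite (twist_permE _ _ _ xE) xE.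
have -> : e0 = vec 1 0 0 0 by rewrite /frame_vec scale1r !scale0r !addr0.
by rewrite twist_map_vec; congr (<[vec _ _ _ _]>%VS); ring.
Qed.

Definition twist_set := [set twist_perm t.1.1 t.1.2 t.2 | t : F * F * F].

Lemma twist_setP g :
  reflect (exists c a b, g = twist_perm c a b) (g \in twist_set).
Proof.
apply: (iffP imsetP) => [[[[c a] b] _ ->] | [c [a [b ->]]]].
  by exists c, a, b.
by exists (c, a, b).
Qed.

Lemma twist_group_set : group_set twist_set.
Proof.
apply/group_setP; split.
  apply/twist_setP; exists 0, 0, 0.
  apply: (mulgI (twist_perm 0 0 0)); rewrite mulg1 twist_permM f0.
  by apply: eq_twist_perm; ring.
move=> _ _ /twist_setP[c [a [b ->]]] /twist_setP[c' [a' [b' ->]]].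
by rewrite twist_permM; apply/twist_setP; do 3![eexists].
Qed.

Definition twist_group := Group twist_group_set.

Lemma twist_group_stab : twist_group \subset stab_geom lines x.
Proof.
by apply/subsetP=> _ /twist_setP[c [a [b ->]]]; apply: twist_perm_stab.
Qed.

Definition payne_twist c a b : {perm payne_point lines x} :=
  payne_act lines x (twist_perm c a b).

Definition payne_twist_group : {group {perm payne_point lines x}} :=
  (actperm ('P^?) @* twist_group)%G.

Lemma payne_twist_groupE :
  payne_twist_group = payne_restr lines x twist_group :> {set _}.
Proof. by []. Qed.

Lemma payne_twist_groupP g :
  reflect (exists c a b, g = payne_twist c a b) (g \in payne_twist_group).
Proof.
rewrite payne_twist_groupE (payne_restrE twist_group_stab).
apply: (iffP imsetP) => [[_ /twist_setP[c [a [b ->]]] ->] | [c [a [b ->]]]].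
  by exists c, a, b.
by exists (twist_perm c a b) => //; apply/twist_setP; exists c, a, b.
Qed.

(** * Affine coordinates and regularity *)

Lemma vec1_neq0 z u v : vec z u v 1 != 0.
Proof.
apply/eqP=> /(congr1 (B e0)); rewrite (coord_vec altB fr) linear0r.
by move/eqP; rewrite oner_eq0.
Qed.

Definition affine_point z u v : W_point F := point (vec1_neq0 z u v).

Lemma affine_pointE z u v : val (affine_point z u v) = <[vec z u v 1%R]>%VS.
Proof. by []. Qed.

Lemma affine_point_inj z u v z' u' v' :
  affine_point z u v = affine_point z' u' v' -> [/\ z = z', u = u' & v = v'].
Proof.
move/(congr1 val); rewrite !affine_pointE => eq_l.
have /vlineP[k] : vec z u v 1 \in <[vec z' u' v' 1%R]>%VS.
  by rewrite -eq_l memv_line.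
rewrite vecZ => /(vec_inj altB fr)[-> -> -> /esym].
by rewrite mulr1 => ->; rewrite !mul1r.
Qed.

(** Not being collinear with [x] means that the coordinate [B e0 v] is nonzero, so [v] can be scaled
    to make it 1. *)
Lemma affine_pointP (y : W_point F) :
  reflect (exists z u v, y = affine_point z u v) (~~ collinear lines x y).
Proof.
apply: (iffP idP) => [|[z [u [v ->]]]]; last first.
  rewrite (collinearE altB ndB xE (affine_pointE _ _ _)) (coord_vec altB fr).
  exact: oner_neq0.
have [v nzv yE] := W_pointE y; rewrite (collinearE altB ndB xE yE) => nz3.
exists (B v e3 / B e0 v), (B e2 v / B e0 v), (B v e1 / B e0 v).
apply: val_inj; rewrite affine_pointE yE.
have -> : vec (B v e3 / B e0 v) (B e2 v / B e0 v) (B v e1 / B e0 v) 1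
    = (B e0 v)^-1 *: v.
  have := congr1 (fun w => (B e0 v)^-1 *: w) (vec_coord altB fr v).
  by rewrite /= vecZ (mulVf nz3) !(mulrC _^-1) => ->.
apply/eqP; rewrite eqEsubv -!memvE memvZ ?memv_line // andbT.
by apply/vlineP; exists (B e0 v); rewrite scalerA divff // scale1r.
Qed.

Lemma twist_perm_affine c a b z u v : twist_perm c a b (affine_point z u v) =
  affine_point (z + c + b * (u + f b * v) - a * v) (u + f b * v + a) (v + b).
Proof.
apply: val_inj; rewrite (twist_permE _ _ _ (affine_pointE _ _ _)) affine_pointE.
by rewrite twist_map_vec !mulr1.
Qed.

Lemma payne_affine z u v : ~~ collinear lines x (affine_point z u v).
Proof. by apply/affine_pointP; exists z, u, v. Qed.

Definition payne_affine_point z u v : payne_point lines x :=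
  Sub (affine_point z u v) (payne_affine z u v).

(** The action is triangular: the last coordinate gives [b = 0], hence [f b = 0]; then the middle
    one gives [a = 0] and the first [c = 0]. *)
Lemma twist_perm_free c a b z u v :
  twist_perm c a b (affine_point z u v) = affine_point z u v ->
  twist_perm c a b = 1%g.
Proof.
rewrite twist_perm_affine => /affine_point_inj[+ + /eqP].
rewrite -[X in _ == X]addr0 (inj_eq (addrI v)) => + + /eqP b0.
rewrite b0 f0 !mul0r !addr0 => + /eqP.
rewrite -[X in _ == X]addr0 (inj_eq (addrI u)) => + /eqP a0.
rewrite a0 mul0r subr0 => /eqP.
rewrite -[X in _ == X]addr0 (inj_eq (addrI z)) => /eqP ->.
apply: (mulgI (twist_perm 0 0 0)); rewrite twist_permM mulg1 f0.
by apply: eq_twist_perm; ring.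
Qed.

Lemma twist_perm_trans z u v z' u' v' : exists2 g, g \in twist_group &
  g (affine_point z u v) = affine_point z' u' v'.
Proof.
(* The parameters are solved for one coordinate at a time, starting from the last. *)
pose b := v' - v; pose a := u' - u - f b * v.
exists (twist_perm (z' - z - b * (u + f b * v) + a * v) a b).
  by apply/twist_setP; do 3![eexists].
by rewrite twist_perm_affine; congr affine_point; rewrite /a /b; ring.
Qed.

Lemma twist_group_regular :
  regular_on twist_group [set y | ~~ collinear lines x y].
Proof.
split.
  apply/imsetP; exists (affine_point 0 0 0); first by rewrite inE payne_affine.
  apply/setP=> y; rewrite inE; apply/affine_pointP/orbitP.
    case=> z [u [v ->]]; have [g Gg <-] := twist_perm_trans 0 0 0 z u v.
    by exists g.
  case=> _ /twist_setP[c [a [b ->]]] <- /=.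
  by rewrite apermE twist_perm_affine; do 3![eexists].
move=> y; rewrite inE => /affine_pointP[z [u [v ->]]].
apply/trivgP/subsetP=> _ /setIP[/twist_setP[c [a [b ->]]] /astab1P /=].
by rewrite apermE => /twist_perm_free->; apply: set11.
Qed.

Lemma payne_twist_regular : payne_regular payne_twist_group.
Proof.
split.
  apply/subsetP=> _ /payne_twist_groupP[c [a [b ->]]].
  exact/payne_act_Aut/twist_perm_stab.
split.
  apply/imsetP; exists (payne_affine_point 0 0 0).
    exact: in_setT.
  apply/setP=> y; rewrite inE; apply/esym/orbitP.
  have /affine_pointP[z [u [v yE]]] := valP y.
  have [g Gg gy] := twist_perm_trans 0 0 0 z u v.
  exists (payne_act lines x g).
    by rewrite payne_twist_groupE (payne_restrE twist_group_stab) imset_f.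
  apply: val_inj; rewrite /= apermE val_payne_act ?yE //.
  exact: (subsetP twist_group_stab).
move=> y _; have /affine_pointP[z [u [v yE]]] := valP y.
apply/trivgP/subsetP=> _ /setIP[/payne_twist_groupP[c [a [b ->]]] /astab1P /=].
rewrite apermE => /(congr1 val); rewrite val_payne_act ?twist_perm_stab // yE.
move/twist_perm_free => g1; rewrite /payne_twist g1 inE.
apply/eqP/permP=> w; apply: val_inj.
by rewrite val_payne_act ?group1 // !perm1.
Qed.

Lemma payne_twist_heisenberg :
  twisted_heisenberg f payne_twist_group payne_twist.
Proof.
split=> //.
- move=> c a b c' a' b'; rewrite /payne_twist -twist_permM.
  by rewrite payne_actM ?twist_perm_stab.
(* The image of the origin recovers the parameters. *)
- move=> c a b c' a' b' /(congr1 (fun g : {perm payne_point lines x} =>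
    val (g (payne_affine_point 0 0 0)))).
  rewrite !val_payne_act ?twist_perm_stab // !twist_perm_affine.
  by case/affine_point_inj; rewrite !mulr0 !addr0 !mulr0 !subr0 !add0r !addr0.
- by move=> c a b; apply/payne_twist_groupP; exists c, a, b.
by move=> g /payne_twist_groupP.
Qed.

Lemma payne_twist_sub :
  payne_twist_group \subset payne_restr lines x (stab_geom lines x).
Proof. exact: morphimS twist_group_stab. Qed.

(** * Elation groups *)

Lemma untwisted_is_elation :
  (forall b, f b = 0) -> is_elation payne_twist_group.
Proof.
move=> fb0; exists twist_group; split=> //; first exact: twist_group_stab.
exists x; split=> [|||]; last exact: twist_group_regular.
- by apply/subsetP=> g /(subsetP twist_group_stab) /stab_geomP[].
- apply/subsetP=> g /(subsetP twist_group_stab) /stab_geomP[_ gx].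
  exact/astab1P.
move=> _ /imsetP[U + ->]; rewrite !inE => /andP[_ /forall_inP isoU] xU.
have e0U : e0 \in U by rewrite memvE -xE.
apply/subsetP=> _ /twist_setP[c [a [b ->]]]; rewrite !inE.
apply/subsetP=> y; rewrite !inE /= apermE => yU.
have [v _ yE] := W_pointE y; rewrite (twist_permE _ _ _ yE).
have vU : v \in U by rewrite memvE -yE.
have /forall_inP/(_ v vU)/eqP v3 := isoU e0 e0U.
(* A vector orthogonal to [e0] is moved by a multiple of [e0], so it stays in every line through [x]
   that contains it. *)
have -> : twist_map c a b v = v + (b * B e2 v - a * B v e1) *: e0.
  have -> : e0 = vec 1 0 0 0 by rewrite /frame_vec scale1r !scale0r !addr0.
  rewrite [X in _ = X + _](vec_coord altB fr v) vecZ vecD /twist_map v3 fb0.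
  by congr (frame_vec _ _ _ _); ring.
by rewrite -memvE rpredD ?rpredZ.
Qed.

(** If the line [<e0, e2>] is preserved, [<e2>] goes to some [<k e0 + m e2>]. It is collinear with
    the affine points [(0, 0, s)], and comparing with their images gives [k + m * (f b0 * s) = 0]
    for all [s]. *)
Lemma fixed_line_twist (G : {group {perm W_point F}}) b0 :
    G \subset stab_geom lines x ->
    payne_restr lines x G = payne_twist_group ->
    {in lines, forall L : {set W_point F}, x \in L -> G \subset 'N(L | 'P)} ->
  f b0 = 0.
Proof.
move=> sG GE Glines.
have /imsetP[g Gg gE] : payne_twist 0 0 b0 \in payne_act lines x @: G.
  by rewrite -payne_restrE // GE; apply/payne_twist_groupP; exists 0, 0, b0.
(* Equality of the induced permutations determines [g] only on the points not collinear with [x]. *)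
have g_affine z u v :
    g (affine_point z u v) = twist_perm 0 0 b0 (affine_point z u v).
  have := congr1 (fun h : {perm payne_point lines x} =>
    val (h (payne_affine_point z u v))) gE.
  by rewrite !val_payne_act ?twist_perm_stab ?(subsetP sG).
have [Ag gx] := stab_geomP _ _ _ (subsetP sG _ Gg).
have nz0 : e0 != 0.
  apply/eqP=> z0; have := form03 fr; rewrite z0 linear0l => /esym/eqP.
  by rewrite oner_eq0.
have nz2 : e2 != 0.
  apply/eqP=> z2; have := form21 fr; rewrite z2 linear0l => /esym/eqP.
  by rewrite oner_eq0.
have e20 : e2 \notin <[e0]>%VS.
  apply/vlineP=> -[k e2E]; have := form21 fr.
  rewrite e2E formZl (form01 fr) mulr0.
  by move/esym/eqP; rewrite oner_eq0.
pose U := (<[e0]> + <[e2]>)%VS; pose L := [set y : W_point F | (val y <= U)%VS].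
have Ll : L \in lines.
  by apply: imset_f; rewrite inE isotropic_line // (form02 fr).
have xL : x \in L by rewrite inE xE addvSl.
have y2L : point nz2 \in L by rewrite inE /= addvSr.
have gy2L : g (point nz2) \in L.
  by rewrite -(astabs_act _ (subsetP (Glines L Ll xL) g Gg)) in y2L.
have [w nzw wE] := W_pointE (g (point nz2)).
have /memv_addP[_ /vlineP[k ->] [_ /vlineP[m ->] wkm]] : w \in U.
  by move: gy2L; rewrite inE wE -memvE.
have {}wkm : w = vec k 0 m 0 by rewrite wkm /frame_vec !scale0r !addr0.
have km s : k + m * (f b0 * s) = 0.
  have : collinear lines (point nz2) (affine_point 0 0 s).
    rewrite (collinearE altB ndB (val_point nz2) (affine_pointE _ _ _)).
    by rewrite (coord_vec altB fr).
  rewrite -(Aut_geom_collinear _ _ Ag) g_affine twist_perm_affine.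
  rewrite (collinearE altB ndB wE (affine_pointE _ _ _)) wkm (form_vec altB fr).
  by move/eqP=> <-; ring.
have k0 : k = 0 by rewrite -(km 0); ring.
have /eqP := km 1; rewrite k0 add0r mulr1 mulf_eq0 => /orP[/eqP m0 | /eqP //].
by rewrite wkm k0 m0 /frame_vec !scale0r !addr0 eqxx in nzw.
Qed.

(** Collinearity with [y] is an affine equation in [(z, u, v)], and it is nonconstant unless [y] is
    spanned by [e0]. *)
Lemma perp_affine (y : W_point F) : y != x ->
  exists z u v z' u' v', collinear lines y (affine_point z u v)
    && ~~ collinear lines y (affine_point z' u' v').
Proof.
have [w _ yE] := W_pointE y => yx.
have collE z u v : collinear lines y (affine_point z u v) =
    (B w e3 - B e0 w * z - B e2 w * v + B w e1 * u == 0).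
  rewrite (collinearE altB ndB yE (affine_pointE _ _ _)).
  by rewrite {1}(vec_coord altB fr w) (form_vec altB fr) mulr1.
have [nz3 | z3] := boolP (B e0 w != 0).
  exists (B w e3 / B e0 w), 0, 0, ((B w e3 - 1) / B e0 w), 0, 0.
  rewrite !collE !mulr0 !(mulrC (B e0 w)) !mulfVK // !subr0 !addr0 subrr eqxx.
  by rewrite opprB addrC subrK oner_neq0.
have [nz1 | z1] := boolP (B e2 w != 0).
  exists 0, 0, (B w e3 / B e2 w), 0, 0, ((B w e3 - 1) / B e2 w).
  rewrite !collE !mulr0 !(mulrC (B e2 w)) !mulfVK // !subr0 !addr0 subrr eqxx.
  by rewrite opprB addrC subrK oner_neq0.
have [nz2 | z2] := boolP (B w e1 != 0).
  exists 0, (- B w e3 / B w e1), 0, 0, ((1 - B w e3) / B w e1), 0.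
  rewrite !collE !mulr0 !(mulrC (B w e1)) !mulfVK // !subr0 subrr eqxx.
  by rewrite addrC subrK oner_neq0.
case/eqP: yx; apply: val_inj; rewrite xE yE; apply/eqP; rewrite eqEdim.
have nzw : w != 0 by have := valP y; rewrite yE dim_vline; case: (w != 0).
rewrite !dim_vline nzw leq_b1 andbT -memvE; apply/vlineP; exists (B w e3).
rewrite {1}(vec_coord altB fr w) (eqP (negbNE z1)) (eqP (negbNE z2)).
by rewrite (eqP (negbNE z3)) /frame_vec !scale0r !addr0.
Qed.

Lemma twisted_not_elation b0 : f b0 != 0 -> ~ is_elation payne_twist_group.
Proof.
move=> fb0 [G [sG GE [y [_ Gy Glines _]]]].
have [yx | yx] := eqVneq y x.
  by rewrite yx in Glines; case/eqP: fb0; apply: fixed_line_twist sG GE Glines.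
(* A group fixing [y] cannot carry an affine point collinear with [y] to one that is not, against
   transitivity. *)
have [z [u [v [z' [u' [v' /andP[]]]]]]] := perp_affine yx.
have [h Hh hE] := twist_perm_trans z u v z' u' v'.
have /imsetP[g Gg gE] : payne_act lines x h \in payne_act lines x @: G.
  rewrite -payne_restrE // GE payne_twist_groupE.
  by rewrite (payne_restrE twist_group_stab) imset_f.
have [Ag _] := stab_geomP _ _ _ (subsetP sG _ Gg).
have gy : g y = y by have /astab1P := subsetP Gy g Gg.
rewrite -(Aut_geom_collinear _ _ Ag) gy.
have <- : h (affine_point z u v) = g (affine_point z u v).
  have := congr1 (fun h : {perm payne_point lines x} =>
    val (h (payne_affine_point z u v))) gE.
  rewrite (val_payne_act _ (subsetP twist_group_stab _ Hh)).
  by rewrite (val_payne_act _ (subsetP sG _ Gg)).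
by rewrite hE => ->.
Qed.

End TwistedAction.

(** * The groups [E], [P] and [S] *)

Lemma exists_twisted_groups (F : finFieldType) (B : {biscalar 'rV[F]_4}%R)
    (x : W_point F) : alternating_form B -> nondegenerate_form B ->
  exists r : (F -> F) -> F -> F -> F -> {perm payne_point (W_lines B) x},
    (forall f c, f 0 = 0 -> r f c 0 0 = r (fun=> 0) c 0 0)%R /\
    forall f, {morph f : b b' / (b + b')%R} ->
    exists G : {group {perm payne_point (W_lines B) x}},
      [/\ twisted_heisenberg f G (r f),
          G \subset payne_restr (W_lines B) x (stab_geom (W_lines B) x),
          payne_regular G,
          (forall b, f b = 0%R) -> is_elation G
        & forall b, f b != 0%R -> ~ is_elation G].
Proof.
move=> altB ndB; have [e0 nz0 xE] := W_pointE x.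
have [e1 [e2 [e3 fr]]] := symplectic_frameP altB ndB nz0.
(* The elements with parameters [(c, 0, 0)] are the same for every twist vanishing at 0; this will
   make the centres of [E] and [P] equal as sets. *)
exists (payne_twist altB ndB fr x); split=> [f c f0 | f fD].
  congr (payne_act _ _ _); apply/permP=> y; apply: val_inj.
  have [v _ yE] := W_pointE y.
  by rewrite !(twist_permE _ _ _ _ _ _ _ yE) /twist_map f0.
exists (payne_twist_group altB ndB fr x fD); split.
- exact: payne_twist_heisenberg.
- exact: payne_twist_sub.
- exact: payne_twist_regular.
- exact: untwisted_is_elation.
- by move=> b; apply: twisted_not_elation.
Qed.

Theorem theorem1p2 (p f q : nat) (F : finFieldType)
    (B : {biscalar 'rV[F]_4}%R) (x : W_point F) :
  prime p -> q = (p ^ f)%N -> #|F| = q ->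
  alternating_form B -> nondegenerate_form B ->
  exists E P : {group {perm payne_point (W_lines B) x}},
    [/\ (* E and P are distinct, come from the stabiliser of x in the
           automorphism group of W(3,q), and act regularly on Q^x *)
        [/\ E :!=: P,
            E \subset payne_restr (W_lines B) x (stab_geom (W_lines B) x),
            P \subset payne_restr (W_lines B) x (stab_geom (W_lines B) x),
            payne_regular E & payne_regular P],
        (* (1) *) is_elation E /\ ~ is_elation P,
        (* (3) *)
        (E \isog P) <-> ~ (exists k, q = (2 ^ k)%N \/ q = (3 ^ k)%N),
        (* (4), (5), (6) for E and P *)
        [/\ ~~ odd q ->
              [/\ 2.-abelem E,
                  exponent P = 4,
                  q <> 2 -> ~~ abelian P,
                  P^`(1) \proper 'Z(P)
                & ~ special P],
            q = (3 ^ f)%N -> exponent E = 3 /\ exponent P = 9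
          & odd q ->
              [/\ 'Z(P) = P^`(1), P^`(1) = 'Z(E), 'Z(E) = E^`(1),
                  special P & special E]]
      & (* S *)
        ~~ prime q ->
        exists S : {group {perm payne_point (W_lines B) x}},
          [/\ [/\ S :!=: E, S :!=: P,
                  S \subset payne_restr (W_lines B) x
                              (stab_geom (W_lines B) x)
                & payne_regular S],
              (* (1) *) ~ is_elation S,
              (* (2) *) ~~ (E \isog S) /\ ~~ (P \isog S)
            & (* (4), (5), (6) for S *)
              [/\ ~~ odd q ->
                    [/\ exponent S = 4, ~~ abelian S,
                        S^`(1) \proper 'Z(S) & ~ special S],
                  q = (3 ^ f)%N -> exponent S = 9
                & odd q -> 'Z(S) \proper S^`(1) /\ ~ special S]]].
Proof.
move=> p_pr q_eq cardF altB ndB.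
have q_gt1 : (1 < q)%N by rewrite -cardF finNzRing_gt1.
have f_gt0 : (0 < f)%N by case: f q_eq q_gt1 => [->|].
have cardFp : #|F| = (p ^ f)%N by rewrite cardF.
have pcharFp : (p \in [pchar F])%R by apply: card_finPcharP cardFp p_pr.
have p_dvd_q : p %| q by rewrite q_eq dvdn_exp.
have p_eq r k : prime r -> q = (r ^ k)%N -> p = r.
  move=> r_pr qE; apply/eqP; rewrite -dvdn_prime2 //.
  by move: p_dvd_q; rewrite qE Euclid_dvdX // => /andP[].
have p_even : ~~ odd q -> p = 2.
  rewrite q_eq oddX negb_or => /andP[_ p_odd].
  by case/even_prime: p_pr p_odd => [-> | ->].
have p_odd : odd q -> odd p by rewrite q_eq oddX eqn0Ngt f_gt0.
have nz2 : odd q -> (2%:R != 0 :> F)%R.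
  move=> odd_q; rewrite -(dvdn_pcharf pcharFp) dvdn_prime2 //.
  by apply: contraTneq (p_odd odd_q) => ->.
have [r [r_center twG]] := exists_twisted_groups x altB ndB.
have [|E [twE subE regE /(_ (fun=> erefl)) elatE _]] := twG (fun=> 0%R).
  by move=> b b'; rewrite addr0.
have [//|P [twP subP regP _ /(_ _ (oner_neq0 F)) elatP]] := twG id.
have ZGP := tw_center_scalar_odd twP (fun b b' => mulrC b' b).
have ZGE := tw_center_scalar_odd twE
  (fun b b' => etrans (mul0r b) (esym (mul0r b'))).
have expE := tw_exponent_untwisted twE (fun=> erefl).
have expE_P : (p == 2) || (p == 3) -> exponent P = (p ^ 2)%N.
  move=> p23; apply: (tw_exponent_small twP p23 pcharFp (b0 := 1%R)).
  exact: oner_neq0.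
exists E, P; split=> //.
- split=> //; apply/eqP=> EP; apply: elatP.
  by rewrite -EP.
- split=> [isoEP [k qk] | not23].
    have p23 : (p == 2) || (p == 3).
      by case: qk => [/(p_eq 2 _ isT) | /(p_eq 3 _ isT)] ->.
    (* The exponents are [p] for [E] and [p ^ 2] for [P]. *)
    have := exponent_isog isoEP; rewrite (expE _ pcharFp) (expE_P p23).
    by case/orP: p23 => /eqP->.
  apply: tw_id_isog twE twP _.
  rewrite (natrM F 2 3) mulf_neq0 // -(dvdn_pcharf pcharFp) dvdn_prime2 //.
    by apply/eqP=> p2; case: not23; exists f; left; rewrite q_eq p2.
  by apply/eqP=> p3; case: not23; exists f; right; rewrite q_eq p3.
- split=> [even_q | q3 | odd_q].
  + have p2 := p_even even_q; rewrite p2 in pcharFp expE_P.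
    have propP : P^`(1) \proper 'Z(P).
      (* For the twist [id] the second coordinates of commutators vanish, so [r 0 1 0] is central
         but outside [P']. *)
      apply: (@tw_der1_proper_even _ _ _ _ _ twP (pred1 0%R) 1%R) => //=.
      * by move=> a a' /eqP-> /eqP->; rewrite addr0.
      * by move=> b b'; rewrite mulrC subrr.
      * exact: oner_neq0.
    split=> //.
    * exact: tw_abelem_untwisted twE (fun=> erefl) pcharFp.
    * exact: expE_P.
    (* With [b] different from 0 and 1, the commutator of [r id 0 0 1] and [r id 0 0 b] has first
       coordinate [b * (b - 1)]. *)
    * move=> q_neq2; have /subsetPn[b _] : ~~ ([set: F] \subset [set 0%R; 1%R]).
        apply: contra_notN q_neq2 => /subset_leq_card.
        rewrite cardsT cardF cards2 eq_sym oner_neq0 => q_le2.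
        by apply/eqP; rewrite eqn_leq q_le2 q_gt1.
      rewrite !inE negb_or => /andP[b_neq0 b_neq1].
      apply: (tw_nonabelian twP (b := 1%R) (b' := b)); apply/orP; right.
      by rewrite mul1r mulf_neq0 // subr_eq0.
    * by case=> _ ZP; rewrite ZP properxx in propP.
  + have p3 := p_eq 3 f isT q3; rewrite p3 in pcharFp expE_P.
    by rewrite (expE _ pcharFp) expE_P.
  + split; [exact/ZGP/nz2 | | exact/ZGE/nz2 | | ].
    * rewrite -(ZGP (nz2 odd_q)); apply/setP=> g.
      apply/idP/idP => [/(tw_center_odd twP _ (nz2 odd_q))[c ->] |].
        by apply/(tw_center_odd twE _ (nz2 odd_q)); exists c; apply: r_center.
      case/(tw_center_odd twE _ (nz2 odd_q))=> c ->.
      apply/(tw_center_odd twP _ (nz2 odd_q)); exists c.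
      by rewrite [RHS]r_center.
    * apply: (tw_special_odd twP _ (p_odd odd_q) pcharFp).
        by move=> b b'; rewrite mulrC.
      exact: tw_pgroup twP p_pr cardFp.
    * apply: (tw_special_odd twE _ (p_odd odd_q) pcharFp).
        by move=> b b'; rewrite !mul0r.
      exact: tw_pgroup twE p_pr cardFp.
move=> q_not_prime.
have f_gt1 : (1 < f)%N.
  rewrite ltn_neqAle f_gt0 andbT.
  by apply: contraNneq q_not_prime => f1; rewrite q_eq -f1 expn1.
pose tr := @abs_trace F p f.
have trD : {morph tr : b b' / (b + b')%R} := abs_traceD f pcharFp.
have [b1 tr_b1] : exists b, (tr b != 0)%R :=
  abs_trace_neq0 pcharFp cardFp f_gt1.
have [b0 b0_neq0 tr_b0] : exists2 b, (b != 0)%R & (tr b = 0)%R :=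
  abs_trace_kernel pcharFp cardFp f_gt1.
have [S [twS subS regS _ /(_ _ tr_b1) elatS]] := twG tr trD.
have tr_comm : (tr b1 * b0 - tr b0 * b1 != 0)%R.
  by rewrite tr_b0 mul0r subr0 mulf_neq0.
have expS : (p == 2) || (p == 3) -> exponent S = (p ^ 2)%N.
  by move=> p23; apply: (tw_exponent_small twS p23 pcharFp tr_b1).
have ZGS : odd q -> 'Z(S) \proper S^`(1).
  by move=> /nz2 nz; apply: (tw_center_proper_odd twS nz tr_comm).
have not_isoE : ~~ (E \isog S).
  (* For [q] odd, centre and derived subgroup coincide in [E] but not in [S]; for [q] even, the
     exponents are 2 and 4. *)
  have [odd_q | even_q] := boolP (odd q); apply/negP=> isoES.
    have := ZGS odd_q; rewrite (isog_center_der1 isoES) ?properxx //.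
    exact/ZGE/nz2.
  have p2 := p_even even_q; have := exponent_isog isoES.
  by rewrite (expE _ pcharFp) expS p2.
have not_isoP : ~~ (P \isog S).
  (* For [q] even, [P] and [S] both have exponent 4, and noncentral involutions of [S] distinguish
     them. *)
  have [odd_q | even_q] := boolP (odd q); apply/negP=> isoPS.
    have := ZGS odd_q; rewrite (isog_center_der1 isoPS) ?properxx //.
    exact/ZGP/nz2.
  have char2 := pcharFp; rewrite (p_even even_q) in char2.
  have [g Sg [g2 /negP[]]] :=
    tw_involution_noncentral twS char2 b0_neq0 tr_b0 tr_b1.
  apply: isog_involution_central isoPS _ g Sg g2.
  by apply: tw_involution_central twP char2 _.
exists S; split=> //.
  split=> //.
    by apply: contraNneq not_isoE => ->; apply: isog_refl.
  by apply: contraNneq not_isoP => ->; apply: isog_refl.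
split=> [even_q | q3 | odd_q].
- have p2 := p_even even_q.
  have char2 := pcharFp; rewrite p2 in char2.
  have trB b b' : (tr (b - b') = tr b - tr b')%R.
    by apply: (addIr (tr b')); rewrite -trD !subrK.
  have propS : S^`(1) \proper 'Z(S).
    (* The kernel of the trace bounds the second coordinates in [S']: traces lie in the prime field,
       so [tr (tr b' * b - tr b * b')] is [tr b' * tr b - tr b * tr b'], which is 0. *)
    apply: (@tw_der1_proper_even _ _ _ _ _ twS (fun a => tr a == 0%R) b1) => //.
    + by rewrite (twist0 twS).
    + by move=> a a' /eqP ta /eqP ta'; rewrite trD ta ta' addr0.
    + have trp b : (tr b ^+ p = tr b)%R.
        by rewrite /tr abs_trace_Frobenius // abs_trace_fixed.
      by move=> b b'; rewrite trB /tr !abs_traceZ ?trp // mulrC subrr.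
  split=> //.
  + by rewrite expS p2.
  + by apply: (tw_nonabelian twS (b := b0) (b' := b1)); rewrite tr_comm.
  + by case=> _ ZS; rewrite ZS properxx in propS.
- have p3 := p_eq 3 f isT q3.
  by rewrite expS p3.
split; first exact: ZGS.
by case=> _ ZS; have := ZGS odd_q; rewrite ZS properxx.
Qed.
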